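(* Let $m\geq 3$. For any nonzero real number $k$, there does not exist any real hypersurface $M$ in $\mathbb{C}P^m$ such that $A_T^{(k)}(X,\phi Y)=\phi A_T^{(k)}(X,Y)$ for any $X,Y\in\mathbb{D}$.
   Context: $\mathbb{C}P^m$ is complex projective space with its Kaehlerian structure $(J,g)$, where $g$ is the Fubini-Study metric of constant holomorphic sectional curvature $4$. All manifolds, vector fields, etc. are of class $C^\infty$. A real hypersurface $M$ is connected and without boundary; $g$ also denotes the induced metric on $M$ and $\nabla$ the Levi-Civita connection of $M$. $N$ is a locally defined unit normal vector field on $M$, $A$ is the shape operator of $M$ associated to $N$ (so $AX=-\overline{\nabla}_XN$, with $\overline{\nabla}$ the Levi-Civita connection of $\mathbb{C}P^m$), and $\xi=-JN$ is the structure (Reeb) vector field. For $X$ tangent to $M$ write $JX=\phi X+\eta(X)N$, where $\phi X$ is the tangential component of $JX$ and $\eta(X)=g(X,\xi)$; $\phi$ is called the structure tensor. $\mathbb{D}$ is the maximal holomorphic distribution on $M$, consisting at each point of the tangent vectors orthogonal to $\xi$. For a nonzero real number $k$ and $X,Y$ tangent to $M$, set $F^{(k)}_XY=g(\phi AX,Y)\xi-\eta(Y)\phi AX-k\eta(X)\phi Y$ (the $k$-th Cho operator) and $T^{(k)}_XY=F^{(k)}_XY-F^{(k)}_YX$ (the $k$-th torsion operator). For $X,Y$ tangent to $M$, $A_T^{(k)}(X,Y)=[T^{(k)}_X,A]Y=T^{(k)}_XAY-AT^{(k)}_XY$. *)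

(* Defs.v *)
(* MathComp-Analysis development.

   Complex projective space CP^m is the set of complex lines of C^(m+1), read in
   its m+1 affine charts, each identified with R^(2m) = 'rV[R]_(m + m) (first
   half: real parts, second half: imaginary parts).  Tangent vectors of CP^m at a
   point of an affine chart are written as elements of R^(2m), and tangent
   vectors of a hypersurface are identified with their images in R^(2m). *)
From HB Require Import structures.
From mathcomp Require Import all_boot all_order all_algebra.
From mathcomp Require Import all_classical all_reals all_analysis.
From mathcomp Require Import complex.

Set Implicit Arguments.
Unset Strict Implicit.
Unset Printing Implicit Defensive.

Import Order.TTheory GRing.Theory Num.Theory.
Import numFieldNormedType.Exports.

Local Open Scope classical_set_scope.
Local Open Scope ring_scope.
Local Open Scope complex_scope.

(* For [U] open: [f] is of class C^r on [U]. *)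
Fixpoint Ck (R : realType) (V W : normedModType R) (r : nat) (U : set V)
    (f : V -> W) : Prop :=
  match r with
  | 0 => {in U, continuous f}
  | r'.+1 => (forall x, U x -> differentiable f x) /\
             (forall v : V, Ck r' U ('D_v f))
  end.

Definition smooth_on (R : realType) (V W : normedModType R) (U : set V)
    (f : V -> W) : Prop := forall r : nat, Ck r U f.

(* A Riemannian metric on a vector space [V] is given as [g x a b], the product
   of the vectors [a] and [b] at the point [x].  A connection is given by its
   Christoffel map: nabla_a b = D_a b + Gamma x a b.  The conditions below are
   tensoriality, torsion-freeness, and nabla g = 0, tested on constant fields. *)
Definition is_levi_civita (R : realType) (V : normedModType R)
    (g : V -> V -> V -> R) (Gamma : V -> V -> V -> V) : Prop :=
  forall x : V,
    [/\ forall v : V, linear (Gamma x v),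
        forall v w : V, Gamma x v w = Gamma x w v
      & forall v a b : V, is_derive x v (fun y => g y a b)
          (g x (Gamma x v a) b + g x a (Gamma x v b))].

Definition levi_civita (R : realType) (V : normedModType R)
    (g : V -> V -> V -> R) : V -> V -> V -> V :=
  xget (fun _ _ _ => 0) [set Gamma | is_levi_civita g Gamma].

Section ComplexProjectiveSpace.
Context {R : realType} {m : nat}.

Definition CP : Type := {L : {vspace 'rV[R[i]]_m.+1} | \dim L == 1%N}.

Definition complexify (x : 'rV[R]_(m + m)) : 'rV[R[i]]_m :=
  \row_k (lsubmx x 0 k +i* rsubmx x 0 k).

Definition realify (z : 'rV[R[i]]_m) : 'rV[R]_(m + m) :=
  row_mx (\row_k complex.Re (z 0 k)) (\row_k complex.Im (z 0 k)).

Definition affine_dom (j : 'I_m.+1) (L : CP) : Prop := vpick (val L) 0 j != 0.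

Definition affine_coord (j : 'I_m.+1) (L : CP) : 'rV[R]_(m + m) :=
  realify (\row_k (vpick (val L) 0 (lift j k) / vpick (val L) 0 j)).

Definition insert_entry (j : 'I_m.+1) (a : R[i]) (z : 'rV[R[i]]_m) :
    'rV[R[i]]_m.+1 :=
  \row_i oapp (fun k => z 0 k) a (unlift j i).

Definition hdot (z w : 'rV[R[i]]_m.+1) : R[i] := \sum_i z 0 i * conjc (w 0 i).

(* The metric in homogeneous coordinates: the pairing at the line of [z] of the
   images of [v] and [w] under the differential of C^(m+1) \ {0} -> CP^m.  This
   is the quotient of the unit sphere metric, so that the holomorphic sectional
   curvature is 4. *)
Definition fubini_study_hom (z v w : 'rV[R[i]]_m.+1) : R :=
  complex.Re ((hdot v w * hdot z z - hdot v z * hdot z w) / hdot z z ^+ 2).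

Definition fubini_study (j : 'I_m.+1) (x v w : 'rV[R]_(m + m)) : R :=
  fubini_study_hom (insert_entry j 1 (complexify x))
    (insert_entry j 0 (complexify v)) (insert_entry j 0 (complexify w)).

Definition J (v : 'rV[R]_(m + m)) : 'rV[R]_(m + m) :=
  realify ((0 +i* 1) *: complexify v).

End ComplexProjectiveSpace.
Arguments CP : clear implicits.

Section Hypersurfaces.
Context {R : realType}.

Record chart (T : topologicalType) (n : nat) := Chart {
  chart_dom : set T;
  chart_cod : set 'rV[R]_n;
  chart_map : T -> 'rV[R]_n;
  chart_inv : 'rV[R]_n -> T;
  chart_dom_open : open chart_dom;
  chart_cod_open : open chart_cod;
  chart_map_cod : forall p, chart_dom p -> chart_cod (chart_map p);
  chart_inv_dom : forall u, chart_cod u -> chart_dom (chart_inv u);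
  chart_mapK : forall p, chart_dom p -> chart_inv (chart_map p) = p;
  chart_invK : forall u, chart_cod u -> chart_map (chart_inv u) = u;
  chart_map_cont : {in chart_dom, continuous chart_map};
  chart_inv_cont : {in chart_cod, continuous chart_inv}
}.

Definition is_smooth_atlas (T : topologicalType) (n : nat)
    (atlas : set (chart T n)) : Prop :=
  (forall p : T, exists2 c, atlas c & chart_dom c p) /\
  (forall c c', atlas c -> atlas c' ->
     smooth_on (chart_cod c `&` chart_inv c @^-1` chart_dom c')
       (chart_map c' \o chart_inv c)).

(* The domain on which a map to CP^m can be written in the chart [c] of its
   source and the [j]-th affine chart of CP^m, and its expression there. *)
Definition expr_dom (m : nat) (T : topologicalType) (n : nat) (i : T -> CP R m)
    (c : chart T n) (j : 'I_m.+1) : set 'rV[R]_n :=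
  [set u | chart_cod c u /\ affine_dom j (i (chart_inv c u))].

Definition expr (m : nat) (T : topologicalType) (n : nat) (i : T -> CP R m)
    (c : chart T n) (j : 'I_m.+1) (u : 'rV[R]_n) : 'rV[R]_(m + m) :=
  affine_coord j (i (chart_inv c u)).

Definition is_smooth_immersion (m : nat) (T : topologicalType) (n : nat)
    (atlas : set (chart T n)) (i : T -> CP R m) : Prop :=
  forall c j, atlas c ->
    [/\ open (expr_dom i c j),
        smooth_on (expr_dom i c j) (expr i c j)
      & forall u, expr_dom i c j u -> injective ('d (expr i c j) u)].

(* Hypersurfaces are immersed; embedded ones are a special case. *)
Record real_hypersurface (m : nat) := RealHypersurface {
  hs_space :> topologicalType;
  hs_hausdorff : hausdorff_space hs_space;
  hs_second_countable : @second_countable hs_space;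
  hs_connected : connected [set: hs_space];
  hs_nonempty : [set: hs_space] !=set0;
  hs_atlas : set (chart hs_space m.*2.-1);
  hs_atlasP : is_smooth_atlas hs_atlas;
  hs_map : hs_space -> CP R m;
  hs_immersion : is_smooth_immersion hs_atlas hs_map
}.

End Hypersurfaces.
Arguments chart : clear implicits.
Arguments real_hypersurface : clear implicits.

(* [f] is the expression of a hypersurface in the [j]-th affine chart, [N] a unit
   normal field along [f], [u] a parameter; tangent vectors [X], [Y] at [u] are
   elements of the image of ['d f u]. *)
Section ShapeOperator.
Context {R : realType} {m n : nat}.
Variables (j : 'I_m.+1) (f N : 'rV[R]_n -> 'rV[R]_(m + m)).

Definition is_unit_normal (W : set 'rV[R]_n) : Prop :=
  smooth_on W N /\
  (forall u, W u -> fubini_study j (f u) (N u) (N u) = 1 /\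
     forall v, fubini_study j (f u) (N u) ('d f u v) = 0).

Variable u : 'rV[R]_n.

Let g (X Y : 'rV[R]_(m + m)) : R := fubini_study j (f u) X Y.

Definition tangent (X : 'rV[R]_(m + m)) : Prop := exists v, 'd f u v = X.

(* The unique [v] with ['d f u v = X] when [X] is tangent and [f] an immersion. *)
Definition param_vec (X : 'rV[R]_(m + m)) : 'rV[R]_n :=
  xget 0 [set v | 'd f u v = X].

Definition nabla_normal (X : 'rV[R]_(m + m)) : 'rV[R]_(m + m) :=
  'd N u (param_vec X) + levi_civita (fubini_study j) (f u) X (N u).

Definition shape_op (X : 'rV[R]_(m + m)) : 'rV[R]_(m + m) := - nabla_normal X.

Definition reeb : 'rV[R]_(m + m) := - J (N u).

Definition eta (X : 'rV[R]_(m + m)) : R := g X reeb.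

Definition phi (X : 'rV[R]_(m + m)) : 'rV[R]_(m + m) := J X - eta X *: N u.

Definition holomorphic_distr (X : 'rV[R]_(m + m)) : Prop :=
  tangent X /\ g X reeb = 0.

Definition cho (k : R) (X Y : 'rV[R]_(m + m)) : 'rV[R]_(m + m) :=
  g (phi (shape_op X)) Y *: reeb - eta Y *: phi (shape_op X)
  - (k * eta X) *: phi Y.

Definition torsion (k : R) (X Y : 'rV[R]_(m + m)) : 'rV[R]_(m + m) :=
  cho k X Y - cho k Y X.

Definition shape_torsion (k : R) (X Y : 'rV[R]_(m + m)) : 'rV[R]_(m + m) :=
  torsion k X (shape_op Y) - shape_op (torsion k X Y).

End ShapeOperator.

(* Up to sign, reversing [N] replaces [k] by [- k] in [shape_torsion], so the
   condition depends on the choice of the local unit normal fields; here [M] is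
   only required to be covered by the domains of some for which it holds. *)
Definition shape_torsion_commutes (R : realType) (m : nat)
    (M : real_hypersurface R m) (k : R) : Prop :=
  forall p : M, exists c j W N,
    let f := expr (@hs_map _ _ M) c j in
    [/\ hs_atlas c /\ chart_dom c p,
        open W /\ W (chart_map c p),
        W `<=` expr_dom (@hs_map _ _ M) c j,
        is_unit_normal j f N W
      & forall u X Y, W u ->
          holomorphic_distr j f N u X -> holomorphic_distr j f N u Y ->
          shape_torsion j f N u k X (phi j f N u Y)
          = phi j f N u (shape_torsion j f N u k X Y)].

(* Main.v *)
(* In an affine chart, with z = (1, x) and s = <z, z> = 1 + |x|^2, the Fubini-Study
   metric is the real part of the Hermitian form (<v, w> s - <v, x> <x, w>) / s^2
   and its Levi-Civita connection is D_v w - (<v, x> w + <w, x> v) / s.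

   Write A xi = alpha xi + B with B orthogonal to xi.  If B <> 0 at a point, the
   components along J B and along Z of the condition, for Z <> 0 orthogonal to
   N, xi, B and J B (here m >= 3 is used), give
   g(A Z, Z) + g(A J Z, J Z) = 0 and g(A Z, Z) = g(A J Z, J Z) = k |Z|^2, so k = 0.
   Hence A xi = alpha xi everywhere, that is theta = - alpha eta for the 1-forms
   eta(v) = g(v, J N) and theta(v) = g(nabla_v N, J N).  Taking exterior
   derivatives on the kernel of eta, where d theta brings in the curvature, gives
   2 A phi A = alpha (phi A + A phi) + 2 phi, while the condition reduces to
   (A - alpha) (phi A + A phi) = 0.  Together they force A = alpha on the
   holomorphic distribution and then 2 alpha^2 = 2 alpha^2 + 2. *)
Require Import Defs.
From mathcomp Require Import all_boot all_order all_algebra.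
From mathcomp Require Import all_classical all_reals all_analysis.
From mathcomp Require Import complex ring lra.

Set Implicit Arguments.
Unset Strict Implicit.
Unset Printing Implicit Defensive.

Import Order.TTheory GRing.Theory Num.Theory.
Import numFieldNormedType.Exports.

Local Open Scope classical_set_scope.
Local Open Scope ring_scope.

(** * The Fubini-Study metric in real affine coordinates *)

Definition dot (R : realType) (d : nat) (a b : 'rV[R]_d) : R :=
  \sum_i a 0 i * b 0 i.

Section DotProduct.
Variables (R : realType) (d : nat).
Implicit Types (a b c : 'rV[R]_d) (r : R).

Lemma dotC a b : dot a b = dot b a.
Proof. by apply: eq_bigr => i _; rewrite mulrC. Qed.

Lemma dotDl a b c : dot (a + b) c = dot a c + dot b c.
Proof. by rewrite -big_split; apply: eq_bigr => i _; rewrite mxE mulrDl. Qed.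

Lemma dotZl r a b : dot (r *: a) b = r * dot a b.
Proof. by rewrite mulr_sumr; apply: eq_bigr => i _; rewrite mxE mulrA. Qed.

Lemma dotDr a b c : dot a (b + c) = dot a b + dot a c.
Proof. by rewrite !(dotC a) dotDl. Qed.

Lemma dotZr r a b : dot a (r *: b) = r * dot a b.
Proof. by rewrite !(dotC a) dotZl. Qed.

Lemma dotNl a b : dot (- a) b = - dot a b.
Proof. by rewrite -scaleN1r dotZl mulN1r. Qed.

Lemma dotNr a b : dot a (- b) = - dot a b.
Proof. by rewrite !(dotC a) dotNl. Qed.

Lemma dot_ge0 a : 0 <= dot a a.
Proof. by apply: sumr_ge0 => i _; rewrite -expr2 sqr_ge0. Qed.

Lemma dot_eq0 a : dot a a = 0 -> a = 0.
Proof.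
move=> /eqP; rewrite psumr_eq0 => [/allP a0|i _]; last by rewrite -expr2 sqr_ge0.
apply/rowP => i; have := a0 i; rewrite mem_index_enum => /(_ isT).
by rewrite mulf_eq0 orbb mxE => /eqP.
Qed.

Lemma dot_gt0 a : a != 0 -> 0 < dot a a.
Proof.
move=> a0; rewrite lt_neqAle dot_ge0 eq_sym andbT.
by apply: contra a0 => /eqP /dot_eq0 ->.
Qed.

Definition dotE := (dotDl, dotDr, dotNl, dotNr, dotZl, dotZr).

End DotProduct.

Section ComplexStructure.
Context {R : realType} {m : nat}.
Implicit Types (a b v w x : 'rV[R]_(m + m)) (r : R).

(* [J] itself unfolds to complex arithmetic in unification. *)
Fact imul_key : unit. Proof. exact: tt. Qed.
Definition imul : 'rV[R]_(m + m) -> 'rV[R]_(m + m) := locked_with imul_key J.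

Lemma imul_J : imul = J.
Proof. exact: unlock. Qed.

Lemma imulE a : imul a = row_mx (- rsubmx a) (lsubmx a).
Proof.
rewrite imul_J /J /realify; congr row_mx; apply/rowP => i; rewrite !mxE /=; ring.
Qed.

Lemma imulD a b : imul (a + b) = imul a + imul b.
Proof. by rewrite !imulE !linearD /= add_row_mx -opprD linearD. Qed.

Lemma imulZ r a : imul (r *: a) = r *: imul a.
Proof. by rewrite !imulE !linearZ /= scale_row_mx scalerN linearZ. Qed.

Lemma imulN a : imul (- a) = - imul a.
Proof. by rewrite -scaleN1r imulZ scaleN1r. Qed.

Lemma imul0 : imul 0 = 0 :> 'rV[R]_(m + m).
Proof. by rewrite -(scale0r 0) imulZ !scale0r. Qed.

Lemma imul_imul a : imul (imul a) = - a.
Proof.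
by rewrite !imulE row_mxKl row_mxKr -{3}[a]hsubmxK opp_row_mx.
Qed.

Lemma dot_hsubmx a b :
  dot a b = dot (lsubmx a) (lsubmx b) + dot (rsubmx a) (rsubmx b).
Proof.
by rewrite /dot big_split_ord /=; congr (_ + _); apply: eq_bigr => i _; rewrite !mxE.
Qed.

Lemma dot_imul a b : dot (imul a) (imul b) = dot a b.
Proof.
by rewrite !imulE !dot_hsubmx !row_mxKl !row_mxKr dotNl dotNr opprK addrC.
Qed.

Lemma dot_imull a b : dot (imul a) b = - dot a (imul b).
Proof. by rewrite -(dot_imul a) imul_imul dotNr opprK. Qed.

Lemma dot_imulr a : dot a (imul a) = 0.
Proof. have := dot_imull a a; rewrite dotC; lra. Qed.

Lemma dot_imulC a b : dot a (imul b) = - dot b (imul a).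
Proof. by rewrite dotC dot_imull. Qed.

(** Since <v, x> = [dot v x] + i [dot v (imul x)], the two subtracted products add up to the real
    part of <v, x> <x, w>. *)
Definition fs x v w : R :=
  (dot v w * (1 + dot x x) - dot v x * dot w x - dot v (imul x) * dot w (imul x))
  / (1 + dot x x) ^+ 2.

(** In homogeneous coordinates a point carries 1 and a tangent vector 0 in slot [j]; splitting off
    that slot leaves the Hermitian product of C^m. *)
Lemma hdot_insert_entry (j : 'I_m.+1) (c1 c2 : R[i]) a b :
  hdot (insert_entry j c1 (complexify a)) (insert_entry j c2 (complexify b))
  = c1 * conjc c2 + Complex (dot a b) (dot a (imul b)).
Proof.
rewrite /hdot (bigD1_ord j) //= !mxE unlift_none /=; congr (_ + _).
under eq_bigr do rewrite !mxE liftK /= !mxE.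
rewrite imulE !dot_hsubmx row_mxKl row_mxKr dotNr.
have eta (z : R[i]) : z = Complex (complex.Re z) (complex.Im z) by case: z.
rewrite [LHS]eta.
rewrite !raddf_sum /= /dot -!big_split /=; congr Complex.
  by apply: eq_bigr => i _; rewrite !mxE; ring.
by apply: eq_bigr => i _; rewrite !mxE; ring.
Qed.

Lemma metric_den_gt0 x : 0 < 1 + dot x x.
Proof. by rewrite ltr_pwDl ?dot_ge0. Qed.

Lemma fubini_studyE (j : 'I_m.+1) : fubini_study j = fs.
Proof.
apply/funext => x; apply/funext => v; apply/funext => w.
rewrite /fubini_study /fubini_study_hom !hdot_insert_entry /fs.
rewrite !dot_imulr (dotC x w) -[dot x (imul w)]opprK -dot_imull (dotC (imul x)).
rewrite (_ : _ + Complex (dot x x) 0 = (1 + dot x x)%:C%C); last first.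
  by rewrite conjc1 mulr1; congr Complex; rewrite /= addr0.
rewrite -rmorphXn /=.
by field; rewrite gt_eqF ?metric_den_gt0.
Qed.

Lemma fsC x v w : fs x v w = fs x w v.
Proof. rewrite /fs (dotC v w); congr (_ / _); ring. Qed.

Lemma fsDl x v1 v2 w : fs x (v1 + v2) w = fs x v1 w + fs x v2 w.
Proof. rewrite /fs !dotDl -mulrDl; congr (_ / _); ring. Qed.

Lemma fsZl x r v w : fs x (r *: v) w = r * fs x v w.
Proof. rewrite /fs !dotZl mulrA; congr (_ / _); ring. Qed.

Lemma fsNl x v w : fs x (- v) w = - fs x v w.
Proof. by rewrite -scaleN1r fsZl mulN1r. Qed.

Lemma fs0l x w : fs x 0 w = 0.
Proof. by rewrite -(scale0r 0) fsZl mul0r. Qed.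

Lemma fsDr x v w1 w2 : fs x v (w1 + w2) = fs x v w1 + fs x v w2.
Proof. by rewrite !(fsC x v) fsDl. Qed.

Lemma fsZr x r v w : fs x v (r *: w) = r * fs x v w.
Proof. by rewrite !(fsC x v) fsZl. Qed.

Lemma fsNr x v w : fs x v (- w) = - fs x v w.
Proof. by rewrite !(fsC x v) fsNl. Qed.

Lemma fs_imul x v w : fs x (imul v) (imul w) = fs x v w.
Proof. rewrite /fs !dot_imul !dot_imull; congr (_ / _); ring. Qed.

Lemma fs_imull x v w : fs x (imul v) w = - fs x v (imul w).
Proof. by rewrite -(fs_imul _ v) imul_imul fsNr opprK. Qed.

Lemma fs_imulC x v w : fs x v (imul w) = - fs x w (imul v).
Proof. by rewrite fsC fs_imull. Qed.

Lemma fs_imulr x v : fs x v (imul v) = 0.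
Proof. have := fs_imull x v v; rewrite fsC; lra. Qed.

Definition fsE := (fsDl, fsDr, fsNl, fsNr, fsZl, fsZr).

(* Cauchy-Schwarz for the Hermitian product: with c = <v, x> the square of the
   norm of |x|^2 v - c x is |x|^2 (|x|^2 |v|^2 - |c|^2). *)
Lemma fs_gt0 x v : v != 0 -> 0 < fs x v v.
Proof.
move=> v0; rewrite divr_gt0 ?exprn_gt0 ?metric_den_gt0 //.
have vv := dot_gt0 v0.
have [->|x0] := eqVneq x 0.
  have d0 w : dot w 0 = 0 by rewrite -(scale0r 0) dotZr mul0r.
  by rewrite imul0 !d0 !mulr0 !subr0 addr0 mulr1.
have xx := dot_gt0 x0.
have := dot_ge0 (dot x x *: v - dot v x *: x - dot v (imul x) *: imul x).
rewrite !dotE !dot_imul !(dotC x v) !(dotC (imul x)) !dot_imulr.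
set p := dot v x; set q := dot v (imul x) => H.
have {}H : 0 <= dot x x * (dot x x * dot v v - p ^+ 2 - q ^+ 2).
  by rewrite (le_trans H) // le_eqVlt; apply/orP; left; apply/eqP; ring.
rewrite pmulr_rge0 // in H.
suff : 0 < dot v v + (dot x x * dot v v - p ^+ 2 - q ^+ 2).
  by congr (0 < _); ring.
exact: ltr_pwDl.
Qed.

End ComplexStructure.

(** * The Levi-Civita connection and its curvature *)

Section RowVectorDerivatives.
Context {R : realType} {V : normedModType R}.
Implicit Types (u w : V).

Lemma is_derive_rowP d u w (a : V -> 'rV[R]_d) (da : 'rV[R]_d) :
  is_derive u w a da <->
  forall i, is_derive u w (fun y => a y 0 i) (da 0 i).
Proof.
split=> [[ad <-] i|H].
  have := (derivable_mxP a u w).1 ad 0 i => adi.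
  by apply: DeriveDef => //; rewrite derive_mx // mxE.
have ad : derivable a u w.
  by apply/derivable_mxP => i j; rewrite (ord1 i); case: (H j).
apply: DeriveDef => //; rewrite derive_mx //; apply/rowP => i; rewrite mxE.
by case: (H i).
Qed.

Lemma is_derive_dot d u w (a b : V -> 'rV[R]_d) da db :
  is_derive u w a da -> is_derive u w b db ->
  is_derive u w (fun y => dot (a y) (b y)) (dot da (b u) + dot (a u) db).
Proof.
move=> /is_derive_rowP Ha /is_derive_rowP Hb.
rewrite /dot; have -> : (fun y => \sum_i a y 0 i * b y 0 i) =
    \sum_(i < d) ((fun y => a y 0 i) * (fun y => b y 0 i)).
  by apply/funext => y; rewrite fct_sumE.
rewrite addrC -big_split /=; apply: is_derive_sum => i.
by rewrite (mulrC (da 0 i)); apply: is_deriveM.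
Qed.

Lemma is_derive_scale d u w (r : V -> R) (a : V -> 'rV[R]_d) dr da :
  is_derive u w r dr -> is_derive u w a da ->
  is_derive u w (fun y => r y *: a y) (dr *: a u + r u *: da).
Proof.
move=> Hr /is_derive_rowP Ha; apply/is_derive_rowP => i.
rewrite (_ : (fun y => (r y *: a y) 0 i) = r * (fun y => a y 0 i)).
  rewrite !mxE addrC (mulrC dr); exact: is_deriveM.
by apply/funext => y; rewrite !mxE.
Qed.

Lemma is_derive_imul m u w (a : V -> 'rV[R]_(m + m)) da :
  is_derive u w a da -> is_derive u w (fun y => imul (a y)) (imul da).
Proof.
move=> /is_derive_rowP Ha; apply/is_derive_rowP => i.
rewrite !imulE; case: (split_ordP i) => k ->.
  rewrite row_mxEl !mxE (_ : (fun y => _) = - (fun y => a y 0 (rshift m k))).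
    exact: is_deriveN.
  by apply/funext => y; rewrite imulE row_mxEl !mxE.
rewrite row_mxEr !mxE (_ : (fun y => _) = (fun y => a y 0 (lshift m k))).
  exact: Ha.
by apply/funext => y; rewrite imulE row_mxEr !mxE.
Qed.

Lemma is_deriveV u w (r : V -> R) dr : r u != 0 -> is_derive u w r dr ->
  is_derive u w (fun y => (r y)^-1) (- (r u) ^- 2 * dr).
Proof.
move=> r0 [rd <-]; apply: DeriveDef; first exact: derivableV.
exact: deriveV.
Qed.

End RowVectorDerivatives.

(* Makes scalar products and complex structures atoms for [mxE] and [ring],
   which would otherwise unfold them. *)
Ltac generalize_dot :=
  repeat match goal with |- context [dot ?a ?b] => generalize (dot a b) => ? end.
Ltac generalize_imul :=
  repeat match goal with |- context [imul ?a] => generalize (imul a) => ? end.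
Ltac vector_ring :=
  generalize_dot; generalize_imul; apply/rowP => ?; rewrite !mxE; ring.

Section LeviCivita.
Context {R : realType} {m : nat}.
Local Notation E := 'rV[R]_(m + m).
Implicit Types (a b v w x : E) (r : R).

(* In complex notation: - (<v, x> w + <w, x> v) / (1 + |x|^2). *)
Definition Gamma x v w : E :=
  (- (1 + dot x x)^-1) *:
    (dot v x *: w + dot v (imul x) *: imul w + dot w x *: v + dot w (imul x) *: imul v).

Lemma GammaC x v w : Gamma x v w = Gamma x w v.
Proof. rewrite /Gamma; vector_ring. Qed.

Lemma GammaDr x v w1 w2 : Gamma x v (w1 + w2) = Gamma x v w1 + Gamma x v w2.
Proof. rewrite /Gamma !(dotDl, imulD); vector_ring. Qed.

Lemma GammaZr x v r w : Gamma x v (r *: w) = r *: Gamma x v w.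
Proof. rewrite /Gamma !(dotZl, imulZ); vector_ring. Qed.

Lemma Gamma_imul x v w : Gamma x v (imul w) = imul (Gamma x v w).
Proof.
rewrite /Gamma imulZ !imulD !imulZ !imul_imul dot_imul dot_imull; vector_ring.
Qed.

Section AlongMap.
Context {V : normedModType R}.
Variables (u w : V) (x a b : V -> E) (dx da db : E).
Hypotheses (Hx : is_derive u w x dx) (Ha : is_derive u w a da)
  (Hb : is_derive u w b db).

Lemma is_derive_metric_den :
  is_derive u w (fun y => 1 + dot (x y) (x y)) (2 * dot (x u) dx).
Proof.
rewrite (_ : 2 * _ = 0 + (dot dx (x u) + dot (x u) dx)); last first.
  by rewrite (dotC dx); ring.
by apply: is_deriveD; apply: is_derive_dot.
Qed.

(** Metric compatibility for fields [a], [b] along a map [x] into the chart: [da + Gamma x dx a] is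
    the covariant derivative of [a] along [x]. Constant fields along the identity give the
    Levi-Civita condition. *)
Lemma is_derive_fs : is_derive u w (fun y => fs (x y) (a y) (b y))
  (fs (x u) (da + Gamma (x u) dx (a u)) (b u)
   + fs (x u) (a u) (db + Gamma (x u) dx (b u))).
Proof.
have s0 : 1 + dot (x u) (x u) != 0 by rewrite gt_eqF ?metric_den_gt0.
have Hix := is_derive_imul Hx.
have Hs := is_derive_metric_den.
have D1 := is_deriveM (is_derive_dot Ha Hb) Hs.
have D2 := is_deriveM (is_derive_dot Ha Hx) (is_derive_dot Hb Hx).
have D3 := is_deriveM (is_derive_dot Ha Hix) (is_derive_dot Hb Hix).
have s20 : (1 + dot (x u) (x u)) ^+ 2 != 0 by rewrite expf_neq0.
have D4 := is_deriveV (r := fun y => (1 + dot (x y) (x y)) ^+ 2) s20 (is_deriveX 2 Hs).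
have D := is_deriveM (is_deriveB (is_deriveB D1 D2) D3) D4.
apply: is_derive_eq D _ => /=.
rewrite !fctE /fs /Gamma; move: (x u) (a u) (b u) s0 {D1 D2 D3 D4 s20 Hix Hs} => X A B.
rewrite !dotE !dot_imul !dot_imull (dotC X dx) ?(dotC dx A) ?(dotC dx B).
rewrite ?(dot_imulC dx A) ?(dot_imulC dx B).
set s := 1 + dot X X; rewrite -/s; clearbody s.
rewrite /GRing.scale /=; generalize_dot.
by move=> *; field.
Qed.

(** The derivative of [Gamma y v w] in the base point along [dy]. The bracket is real linear in [y],
    so its own derivative is the same bracket at [dy]. *)
Definition dGamma y dy v w : E :=
  (2 * dot y dy / (1 + dot y y) ^+ 2) *:
    (dot v y *: w + dot v (imul y) *: imul w + dot w y *: v + dot w (imul y) *: imul v)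
  - (1 + dot y y)^-1 *:
    (dot v dy *: w + dot v (imul dy) *: imul w + dot w dy *: v + dot w (imul dy) *: imul v).

Lemma is_derive_Gamma : is_derive u w (fun y => Gamma (x y) (a y) (b y))
  (dGamma (x u) dx (a u) (b u) + Gamma (x u) da (b u) + Gamma (x u) (a u) db).
Proof.
have s0 : 1 + dot (x u) (x u) != 0 by rewrite gt_eqF ?metric_den_gt0.
have Hix := is_derive_imul Hx.
have D1 := is_derive_scale (is_derive_dot Ha Hx) Hb.
have D2 := is_derive_scale (is_derive_dot Ha Hix) (is_derive_imul Hb).
have D3 := is_derive_scale (is_derive_dot Hb Hx) Ha.
have D4 := is_derive_scale (is_derive_dot Hb Hix) (is_derive_imul Ha).
have D0 := is_deriveN (is_deriveV (r := fun y => 1 + dot (x y) (x y)) s0 is_derive_metric_den).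
have D := is_derive_scale D0 (is_deriveD (is_deriveD (is_deriveD D1 D2) D3) D4).
apply: is_derive_eq D _.
rewrite !fctE /dGamma /Gamma.
move: (x u) (a u) (b u) s0 {D0 D1 D2 D3 D4 Hix} => X A B.
set s := 1 + dot X X; clearbody s; generalize_dot; generalize_imul => *.
by apply/rowP => ?; rewrite !mxE /GRing.scale /=; field.
Qed.

End AlongMap.

(** The left side is g(R(w, v) N, J N) in Christoffel form, the right side its value for constant
    holomorphic sectional curvature 4. *)
Lemma fs_curvature y N v w :
  fs y (dGamma y w v N - dGamma y v w N
        + Gamma y w (Gamma y v N) - Gamma y v (Gamma y w N)) (imul N) =
  - 2 * fs y N N * fs y v (imul w)
  - fs y N w * fs y v (imul N) - fs y N (imul w) * fs y v N
  + fs y N v * fs y w (imul N) + fs y N (imul v) * fs y w N.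
Proof.
have s0 : 1 + dot y y != 0 by rewrite gt_eqF ?metric_den_gt0.
rewrite /fs /dGamma /Gamma.
rewrite !(dotE, imulD, imulZ) !imul_imul !(dotE, dot_imul, dot_imull).
set s := 1 + dot y y in s0 *; clearbody s.
rewrite ?(dotC N v) ?(dotC N w) ?(dotC y v) ?(dotC w v) ?(dotC y w) ?(dotC y N).
rewrite ?(dot_imulC N v) ?(dot_imulC N w) ?(dot_imulC y v) ?(dot_imulC w v).
rewrite ?(dot_imulC y w) ?(dot_imulC y N) ?dot_imulr.
by generalize_dot => *; field.
Qed.

Lemma Gamma_levi_civita : is_levi_civita fs Gamma.
Proof.
move=> x; split=> [v r w1 w2|v w|v a b]; first by rewrite GammaDr GammaZr.
  exact: GammaC.
have := is_derive_fs (is_derive_id x v) (is_derive_cst a x v) (is_derive_cst b x v).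
by rewrite !add0r.
Qed.

Lemma fs_inj y a b : (forall c, fs y a c = fs y b c) -> a = b.
Proof.
move=> ab; apply/eqP; rewrite -subr_eq0; apply/negPn/negP => /(@fs_gt0 _ _ y).
by rewrite fsDl ab -fsDl subrr fs0l ltxx.
Qed.

(* The difference D of two Levi-Civita maps gives a trilinear form g(D(a,b),c),
   symmetric in a, b and skew in b, c, hence zero. *)
Lemma levi_civita_fs : levi_civita fs = Gamma.
Proof.
rewrite /levi_civita; apply: xget_unique; first exact: Gamma_levi_civita.
move=> G HG; apply/funext => x; apply/funext => v; apply/funext => w.
have [_ GC Gd] := HG x; have [_ _ Gd'] := Gamma_levi_civita x.
pose T a b c := fs x (G x a b - Gamma x a b) c.
have TC a b c : T a b c = T b a c by rewrite /T GC GammaC.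
have TN a b c : T a b c = - T a c b.
  have := @derive_val _ _ _ _ _ _ _ (Gd a b c).
  rewrite (@derive_val _ _ _ _ _ _ _ (Gd' a b c)) => /eqP; rewrite -subr_eq0 => /eqP H.
  rewrite /T !fsDl !fsNl; move: H; rewrite !(fsC x b); lra.
apply: (@fs_inj x) => c; apply/eqP; rewrite -subr_eq0 -fsNl -fsDl.
apply/eqP; rewrite -/(T v w c); have := (TN v w c, TN w c v, TN c v w).
rewrite (TC w v) (TC c w) (TC v c); case=> [[]]; lra.
Qed.

End LeviCivita.

(** * Symmetry of second derivatives *)

Section SymmetryOfSecondDerivatives.
Context {R : realType} {V : normedModType R}.
Implicit Types (x v w y : V) (F G H : V -> R).

Lemma is_derive_line F y v r d : is_derive (r *: v + y) v F d ->
  is_derive r 1 (fun t : R => F (t *: v + y)) d.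
Proof.
move=> [Fd <-].
have e : (fun h : R => h^-1 *:
      (((fun t : R => F (t *: v + y)) \o shift r) (h *: 1) - F (r *: v + y)))
    = (fun h : R => h^-1 *: ((F \o shift (r *: v + y)) (h *: v) - F (r *: v + y))).
  by apply/funext => h /=; rewrite scalerDl -addrA /GRing.scale /= mulr1.
by apply: DeriveDef; rewrite /derivable /derive e.
Qed.

(* The mean value theorem along v turns the second difference of F into a
   difference of values of G = D_v F, and G is linear up to o(t) near x. *)
Lemma second_difference F G x v w :
  (\forall y \near x, is_derive y v F (G y)) -> differentiable G x ->
  forall e, 0 < e -> \forall t \near (0 : R)^'+,
    `|F (t *: v + (t *: w + x)) - F (t *: v + x) - (F (t *: w + x) - F x)
      - t ^+ 2 * 'D_w G x| <= e * t ^+ 2.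
Proof.
move=> FG Gx e e0.
(* For 0 <= r <= t and z = w or z = 0 the vector r v + t z has length at most t C; the 1 keeps C
   positive. A first-order error of e / 2 / C per unit length then costs at most (e / 2) t, and it
   occurs twice. *)
pose C := `|v| + `|w| + 1.
have C0 : 0 < C by rewrite ltr_wpDl ?addr_ge0.
have e1 : 0 < e / 2 / C by rewrite !divr_gt0.
have [d1 /= d10 Hd1] := (nbhs_normP _ _).1 FG.
have [d2 /= d20 Hd2] := (nbhs_normP _ _).1 ((eqaddoP _ _ _ _).1 (diff_locally Gx) _ e1).
have d0 : 0 < Num.min d1 d2 by rewrite lt_min d10 d20.
near=> t.
have t0 : 0 < t by near: t; exact: nbhs_right_gt.
have td : t * C < Num.min d1 d2.
  by rewrite -ltr_pdivlMr //; near: t; apply: nbhs_right_lt; rewrite divr_gt0.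
have small r z : 0 <= r <= t -> (z = w) \/ (z = 0) -> `|r *: v + t *: z| <= t * C.
  move=> /andP[r0 rt] zw; apply: le_trans (ler_normD _ _) _.
  rewrite !normrZ (ger0_norm r0) (gtr0_norm t0) /C !mulrDr mulr1.
  have : r * `|v| <= t * `|v| by rewrite ler_wpM2r.
  have : t * `|z| <= t * `|w|.
    by rewrite ler_wpM2l // ?(ltW t0) //; case: zw => ->; rewrite ?normr0.
  lra.
have G_lin r z : 0 <= r <= t -> z = w \/ z = 0 ->
    `|G (r *: v + t *: z + x) - (G x + 'd G x (r *: v + t *: z))| <= e / 2 * t.
  move=> rt zw; have s := small r z rt zw.
  have /Hd2 : ball_ Num.Def.normr (0 : V) d2 (r *: v + t *: z).
    by rewrite /ball_ /= sub0r normrN (le_lt_trans s) // (lt_le_trans td) // ge_min lexx orbT.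
  move=> /= H; apply: le_trans H _.
  rewrite -(mulrA (e / 2)) ler_wpM2l //; first by rewrite divr_ge0 // ltW.
  by rewrite ler_pdivrMl // (mulrC C).
have FD r z : 0 <= r <= t -> z = w \/ z = 0 ->
    is_derive r 1 (fun r : R => F (r *: v + (t *: z + x))) (G (r *: v + t *: z + x)).
  move=> rt zw; rewrite -addrA; apply: is_derive_line; rewrite addrA; apply: Hd1.
  rewrite /= opprD addrA addrAC subrr add0r normrN.
  by rewrite (le_lt_trans (small r z rt zw)) // (lt_le_trans td) // ge_min lexx.
(* Writing [t *: 0] lets the same estimates serve both sides of the parallelogram. *)
pose p (r : R) := F (r *: v + (t *: w + x)) - F (r *: v + (t *: 0 + x)).
have pD r : 0 <= r <= t ->
    is_derive r 1 p (G (r *: v + t *: w + x) - G (r *: v + t *: 0 + x)).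
  by move=> rt; apply: is_deriveB; apply: FD; rewrite //; [left|right].
have [||c ct] := @MVT R p (fun r => G (r *: v + t *: w + x) - G (r *: v + t *: 0 + x)) 0 t t0.
- by move=> r; rewrite in_itv /= => /andP[? ?]; apply: pD; rewrite !ltW.
- by apply: derivable_within_continuous => r; rewrite in_itv /= => /pD [].
have {ct} ct : 0 <= c <= t by move: ct; rewrite in_itv /= => /andP[? ?]; rewrite !ltW.
rewrite /p !scale0r !add0r !scaler0 !add0r subr0 => ->.
have dl r z : 'd G x (r *: v + t *: z) = r * 'd G x v + t * 'd G x z.
  by rewrite linearD !linearZ.
have := G_lin c w ct (or_introl erefl); have := G_lin c 0 ct (or_intror erefl).
rewrite !dl !linear0 !addr0 mulr0 addr0 deriveE //.
set L := 'd G x w; set Lv := 'd G x v; set gx := G x.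
set g0 := G (c *: v + x); set g1 := G (c *: v + t *: w + x) => H0 H1.
rewrite (_ : (g1 - g0) * t - t ^+ 2 * L =
    t * ((g1 - (gx + (c * Lv + t * L))) - (g0 - (gx + c * Lv)))); last by ring.
rewrite normrM (gtr0_norm t0) expr2 mulrA (mulrC e) -mulrA ler_pM2l //.
rewrite (le_trans (ler_normB _ _)) // (splitr e) mulrDl lerD //.
Unshelve. all: by end_near. Qed.

(** The second difference is symmetric in [v] and [w], so it approximates t^2 times either mixed
    derivative. With errors of a quarter of their supposed gap, the gap would be at most half of
    itself. *)
Lemma schwarz F G H x v w :
  (\forall y \near x, is_derive y v F (G y)) ->
  (\forall y \near x, is_derive y w F (H y)) ->
  differentiable G x -> differentiable H x -> 'D_w G x = 'D_v H x.
Proof.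
move=> FG FH Gx Hx; apply/eqP; rewrite -subr_eq0 -normr_eq0 -[_ == 0]negbK.
apply/negP => n0.
have e0 : 0 < `|'D_w G x - 'D_v H x| / 4 by rewrite divr_gt0 // lt_neqAle eq_sym n0 normr_ge0.
have : \forall t \near (0 : R)^'+, False; last by move=> /filter_ex[].
near=> t.
have t0 : 0 < t by near: t; exact: nbhs_right_gt.
have : `|F (t *: v + (t *: w + x)) - F (t *: v + x) - (F (t *: w + x) - F x)
      - t ^+ 2 * 'D_w G x| <= `|'D_w G x - 'D_v H x| / 4 * t ^+ 2.
  by near: t; apply: second_difference.
have : `|F (t *: w + (t *: v + x)) - F (t *: w + x) - (F (t *: v + x) - F x)
      - t ^+ 2 * 'D_v H x| <= `|'D_w G x - 'D_v H x| / 4 * t ^+ 2.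
  by near: t; apply: second_difference.
rewrite addrCA; set a := F _; set b := F _; set c := F _; set d := F x.
set p := 'D_w G x; set q := 'D_v H x => H1 H2.
have : `|t ^+ 2 * (p - q)| <= `|p - q| / 2 * t ^+ 2.
  rewrite (_ : t ^+ 2 * (p - q) = (a - b - (c - d) - t ^+ 2 * q)
      - (a - c - (b - d) - t ^+ 2 * p)); last by ring.
  apply: le_trans (ler_normB _ _) _; lra.
rewrite normrM (gtr0_norm (exprn_gt0 _ t0)) (mulrC (t ^+ 2)) ler_pM2r ?exprn_gt0 //.
rewrite /p /q; lra.
Unshelve. all: by end_near. Qed.

Lemma schwarz_row d (f : V -> 'rV[R]_d) x v w :
  (\forall y \near x, differentiable f y) ->
  differentiable ('D_v f) x -> differentiable ('D_w f) x ->
  'D_w ('D_v f) x = 'D_v ('D_w f) x.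
Proof.
move=> df dv dw.
have nd z i : \forall y \near x, is_derive y z (fun y => f y 0 i) ('D_z f y 0 i).
  near=> y; have fy : differentiable f y by near: y.
  by have /derivableP/is_derive_rowP := @diff_derivable _ _ _ _ y z fy.
have co z i : differentiable ('D_z f) x -> differentiable (fun y => 'D_z f y 0 i) x.
  move=> fz; apply: (@differentiable_comp _ _ _ _ _ (fun M : 'rV[R]_d => M 0 i) _ fz).
  exact: differentiable_coord.
have coD z z' i : differentiable ('D_z f) x ->
    'D_z' ('D_z f) x 0 i = 'D_z' (fun y => 'D_z f y 0 i) x.
  move=> fz; have fz' : derivable ('D_z f) x z' by exact: diff_derivable.
  by have /is_derive_rowP/(_ i)/@derive_val -> := derivableP fz'.
apply/rowP => i; apply: etrans (coD v w i dv) _.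
apply: etrans _ (esym (coD w v i dw)).
exact: (schwarz (nd v i) (nd w i) (co v i dv) (co w i dw)).
Unshelve. all: by end_near. Qed.

End SymmetryOfSecondDerivatives.

(** * The condition at a point *)

Lemma linear_form_delta (R : fieldType) (n : nat) (L : 'rV[R]_n -> R)
    (lL : linear (L : 'rV[R]_n -> R^o)) (z : 'rV[R]_n) :
  L z = \sum_i z 0 i * L (delta_mx 0 i).
Proof.
have L0 : L 0 = 0.
  have := lL 1 0 0; rewrite scaler0 addr0 scale1r => /eqP.
  by rewrite -subr_eq0 opprD addrA subrr add0r oppr_eq0 => /eqP.
rewrite {1}[z]row_sum_delta; elim: (index_enum _) => [|i s IH].
  by rewrite !big_nil.
by rewrite !big_cons lL IH.
Qed.

(** The forms are the columns of an n x p matrix, whose left kernel is nonzero for p < n. This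
    supplies vectors orthogonal to a short list. *)
Lemma exists_common_zero (R : fieldType) (n p : nat) (L : 'I_p -> 'rV[R]_n -> R)
    (lL : forall i, linear (L i : 'rV[R]_n -> R^o)) : (p < n)%N ->
  exists2 z : 'rV[R]_n, z != 0 & forall i, L i z = 0.
Proof.
move=> pn; pose M := \matrix_(i, j) L j (delta_mx 0 i).
have LE (z : 'rV[R]_n) i : L i z = (z *m M) 0 i.
  by rewrite (linear_form_delta (lL i)) mxE; apply: eq_bigr => l _; rewrite mxE.
have K0 : kermx M != 0.
  rewrite -mxrank_eq0 mxrank_ker subn_eq0 -ltnNge.
  exact: leq_ltn_trans (rank_leq_col M) pn.
exists (nz_row (kermx M)); first by rewrite nz_row_eq0.
move=> i; rewrite LE; have /sub_kermxP -> : (nz_row (kermx M) <= kermx M)%MS.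
  exact: nz_row_sub.
by rewrite mxE.
Qed.

Section ShapeOperatorAtPoint.
Context {R : realType} {m : nat}.
Local Notation E := 'rV[R]_(m + m).
Variables (y N : E) (A : E -> E) (k : R).
Local Notation g := (fs y).
Local Notation xi := (- imul N).
Local Notation phi X := (imul X - g X xi *: N).
Local Notation cho X Y :=
  (g (phi (A X)) Y *: xi - g Y xi *: phi (A X) - (k * g X xi) *: phi Y).
Local Notation torsion X Y := (cho X Y - cho Y X).
Local Notation shape_torsion X Y := (torsion X (A Y) - A (torsion X Y)).

Definition tangent_at (X : E) : Prop := g X N = 0.

Definition hol (X : E) : Prop := tangent_at X /\ g X xi = 0.

Hypotheses (gNN : g N N = 1)
  (A_tangent : forall X, tangent_at X -> tangent_at (A X))
  (A_sym : forall X Y, tangent_at X -> tangent_at Y -> g (A X) Y = g X (A Y))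
  (A_lin : forall r X Y, tangent_at X -> tangent_at Y ->
     A (r *: X + Y) = r *: A X + A Y)
  (A_commutes : forall X Y, hol X -> hol Y ->
     shape_torsion X (phi Y) = phi (shape_torsion X Y)).

Let alpha : R := g (A xi) xi.
Let B : E := A xi - alpha *: xi.
(** On holomorphic vectors this is g((phi A + A phi) X, Y), and the torsion of X and Y is
    [d X Y *: xi]. *)
Let d X Y : R := g (imul (A X)) Y - g (imul (A Y)) X.

Let gNxi : g N xi = 0. Proof. by rewrite fsNr fs_imulr oppr0. Qed.

Let tan_xi : tangent_at xi. Proof. by rewrite /tangent_at fsC gNxi. Qed.

Let gxixi : g xi xi = 1. Proof. by rewrite fsNl fsNr opprK fs_imul. Qed.

Let hol_imul X : hol X -> hol (imul X).
Proof.
rewrite /hol /tangent_at !fsNr => -[XN Xxi]; split; last by rewrite fs_imul XN oppr0.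
by rewrite fs_imull.
Qed.

Let hol_lin r X Y : hol X -> hol Y -> hol (r *: X + Y).
Proof.
move=> [XN Xxi] [YN Yxi]; split; rewrite /tangent_at fsDl fsZl.
  by rewrite XN YN mulr0 addr0.
by rewrite Xxi Yxi mulr0 addr0.
Qed.

Let holB : hol B.
Proof.
split; rewrite /tangent_at /B fsDl fsNl fsZl.
  by rewrite A_tangent // tan_xi mulr0 subr0.
by rewrite gxixi mulr1 subrr.
Qed.

Let A_hol Y : hol Y -> g (A Y) xi = g Y B.
Proof. by move=> [YN Yxi]; rewrite A_sym // /B fsDr fsNr fsZr Yxi mulr0 subr0. Qed.

Let phi_hol X : hol X -> phi X = imul X.
Proof. by move=> [_ ->]; rewrite scale0r subr0. Qed.

Let g_phi X Y : tangent_at Y -> g (phi X) Y = g (imul X) Y.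
Proof. by move=> YN; rewrite fsDl fsNl fsZl (fsC _ N) YN mulr0 subr0. Qed.

Let A_scale r X : tangent_at X -> A (r *: X) = r *: A X.
Proof.
move=> tX; have t0 : tangent_at 0 by rewrite /tangent_at fs0l.
have A0 : A 0 = 0.
  have := A_lin 1 t0 t0; rewrite scale1r addr0 scale1r => /eqP.
  by rewrite -subr_eq0 opprD addrA subrr add0r oppr_eq0 => /eqP.
by rewrite -[r *: X]addr0 A_lin // A0 addr0.
Qed.

(** All eta terms of the inner torsion vanish, so [A] is applied only to a multiple of xi. In the
    outer one [A Y] may have a xi component, equal to [g Y B], which produces the two middle
    terms. *)
Let shape_torsion_hol X Y : hol X -> hol Y -> shape_torsion X Y =
  (g (imul (A X)) (A Y) - g (imul (A (A Y))) X) *: xi - g Y B *: phi (A X)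
  + (k * g Y B) *: imul X - d X Y *: A xi.
Proof.
move=> hX hY; have [tX Xxi] := hX; have [tY Yxi] := hY.
rewrite (_ : torsion X Y = d X Y *: xi); last first.
  rewrite Xxi Yxi mulr0 !scale0r !subr0 -scalerBl; congr (_ *: _).
  by rewrite !g_phi.
have tAY := A_tangent tY.
rewrite A_scale // (A_hol hY) !g_phi // (phi_hol hX) Xxi mulr0 !scale0r !subr0.
congr (_ - _); rewrite scalerBl opprB [X in _ - _ + X]addrC addrACA addrA //.
Qed.

Let g_shape_torsion X Y T : hol X -> hol Y -> hol T ->
  g (shape_torsion X Y) T =
  - g Y B * g (imul (A X)) T + k * g Y B * g (imul X) T - d X Y * g B T.
Proof.
move=> hX hY [tT Txi]; rewrite shape_torsion_hol //.
have Txi' : g xi T = 0 by rewrite fsC.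
have : g (A xi) T = g B T by rewrite /B fsDl fsNl fsZl Txi' mulr0 subr0.
have : g (phi (A X)) T = g (imul (A X)) T by rewrite g_phi.
move: (phi (A X)) (g B T) => P b PT AT.
rewrite !(fsDl, fsNl _ (_ *: _)) !fsZl PT AT Txi'; ring.
Qed.

(** Pairing the condition with a holomorphic [T] removes the xi components, and phi on the
    right-hand side moves to [T] by skewness. *)
Let commutes_paired X Y T : hol X -> hol Y -> hol T ->
  - g (imul Y) B * g (imul (A X)) T + k * g (imul Y) B * g (imul X) T
    - d X (imul Y) * g B T =
  g Y B * g (A X) T - k * g Y B * g X T + d X Y * g B (imul T).
Proof.
move=> hX hY hT; have hiY := hol_imul hY; have hiT := hol_imul hT.
have gphiT S : g (phi S) T = - g S (imul T) by rewrite g_phi ?fs_imull //; case: hT.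
have : g (shape_torsion X (imul Y)) T = - g (shape_torsion X Y) (imul T).
  by apply: etrans _ (gphiT _); rewrite -(A_commutes hX hY) (phi_hol hY).
rewrite (g_shape_torsion hX hiY hT) (g_shape_torsion hX hY hiT) !fs_imul => ->.
ring.
Qed.

Lemma shape_op_reeb : (2 < m)%N -> k != 0 -> A xi = g (A xi) xi *: xi.
Proof.
move=> m2 k0; apply/eqP; rewrite -subr_eq0; apply/negPn/negP => B0.
have b0 : 0 < g B B by exact: fs_gt0.
have lin4 (i : 'I_4) : linear ((fun Z => g Z (tnth [tuple N; xi; B; imul B] i)) : E -> R^o).
  by move=> r v w; rewrite fsDl fsZl.
(* Four linear conditions on a space of dimension 2m >= 6. *)
have [|Z Z0 HZ] := exists_common_zero lin4; first exact: leq_trans (leq_add m2 m2).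
have hZ : hol Z by split; [exact: HZ ord0|exact: (HZ (Ordinal (isT : 1 < 4)%N))].
have ZB : g Z B = 0 by exact: (HZ (Ordinal (isT : 2 < 4)%N)).
have ZiB : g Z (imul B) = 0 by exact: (HZ (Ordinal (isT : 3 < 4)%N)).
have iZB : g (imul Z) B = 0 by rewrite fs_imull ZiB oppr0.
have iBB : g (imul B) B = 0 by rewrite fsC fs_imulr.
have hiZ := hol_imul hZ; have hiB := hol_imul holB.
(* With X = Z, Y = J Z, T = J B, only the term in d(Z, J Z) g(B, B) survives. *)
have : d Z (imul Z) = 0.
  have := commutes_paired hZ hiZ hiB.
  rewrite (imul_imul Z) (imul_imul B) (fsNl _ Z B) ZB iZB (fs_imulr _ B) (fsNr _ B) => H.
  by apply: (mulfI (lt0r_neq0 b0)); lra.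
rewrite /d !fs_imul fs_imull opprK => trA.
(* Taking Y = B and X = T = Z, and below X = T = J Z, leaves g(B, B) (g(A X, X) - k g(X, X)) = 0. *)
have AZ : g (A Z) Z = k * g Z Z.
  have := commutes_paired hZ holB hZ.
  rewrite iBB (fsC _ B Z) ZB (fsC _ B (imul Z)) iZB => H.
  by apply: (mulfI (lt0r_neq0 b0)); lra.
have AiZ : g (A (imul Z)) (imul Z) = k * g Z Z.
  have := commutes_paired hiZ holB hiZ.
  rewrite iBB imul_imul (fsC _ B (imul Z)) iZB (fsNr _ B) (fsC _ B Z) ZB (fs_imul _ Z) => H.
  by apply: (mulfI (lt0r_neq0 b0)); lra.
have : k * g Z Z == 0 by apply/eqP; lra.
by rewrite mulf_eq0 (negbTE k0) (gt_eqF (fs_gt0 _ Z0)).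
Qed.

Hypothesis hopf_identity : forall X Y, hol X -> hol Y ->
  2 * g (imul (A X)) (A Y) = g (A xi) xi * d X Y + 2 * g (imul X) Y.

(** For B = 0 every shape torsion of holomorphic vectors is a multiple of xi, so the condition
    becomes one scalar identity, [key], to be played against [hopf_identity]. *)
Lemma hopf_contradiction : (1 < m)%N -> A xi = g (A xi) xi *: xi -> False.
Proof.
move=> m1 Axi.
have B0 : B = 0 by rewrite /B -Axi subrr.
have YB Y : g Y B = 0 by rewrite B0 fsC fs0l.
have hA X : hol X -> hol (A X).
  by move=> hX; have [tX _] := hX; split; [exact: A_tangent|rewrite A_hol].
have st X Y : hol X -> hol Y -> shape_torsion X Y =
    (g (imul (A X)) (A Y) - g (imul (A (A Y))) X - alpha * d X Y) *: xi.
  move=> hX hY; rewrite shape_torsion_hol // YB mulr0 !scale0r subr0 addr0.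
  by rewrite Axi scalerA -scalerBl (mulrC alpha).
(* Apply the condition to X and - J Y, whose image under phi is Y. The other side is phi of a
   multiple of xi, which is zero. *)
have key X Y : hol X -> hol Y ->
    g (imul (A X)) (A Y) - g (imul (A (A Y))) X = alpha * d X Y.
  move=> hX hY; have hiY : hol (- imul Y).
    rewrite -scaleN1r -[_ *: _]addr0; apply: hol_lin; first exact: hol_imul.
    by split; rewrite /tangent_at fs0l.
  have := A_commutes hX hiY; rewrite (st _ _ hX hiY); move: (_ - _ - alpha * d X (- _)) => c'.
  rewrite (phi_hol hiY) imulN imul_imul opprK (st _ _ hX hY).
  rewrite imulZ imulN imul_imul opprK fsZl gxixi mulr1 subrr => /(congr1 (g^~ xi)).
  by rewrite fs0l fsZl gxixi mulr1 => /eqP; rewrite subr_eq0 => /eqP.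
have Aalpha Y : hol Y -> A Y = alpha *: Y.
  move=> hY; pose W := - alpha *: Y + A Y; have hW : hol W by apply: hol_lin => //; exact: hA.
  have AW : A W = - alpha *: A Y + A (A Y).
    by apply: A_lin; [case: hY|case: (hA _ hY)].
  (* By linearity of [d] in its second argument this is [key] for X and Y. *)
  have dW X : hol X -> d X W = 0.
    move=> hX; have := key X Y hX hY; rewrite /d AW /W !fsDr fsZr imulD imulZ fsDl fsZl; lra.
  (* At the pair J W, W the quantity g(J A J W, A W) equals - g(W, W) by [hopf_identity] and g(A W,
     A W) by [key], hence W = 0. *)
  have := hopf_identity (hol_imul hW) hW.
  have := key _ _ (hol_imul hW) hW; rewrite dW ?mulr0 ?add0r; last exact: hol_imul.
  rewrite imul_imul fs_imul fsNl (A_sym (hA _ hW).1 hW.1) => H1 H2.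
  have W0 : W = 0.
    apply/eqP; apply/negPn/negP => W0; have := fs_gt0 y W0.
    have : 0 <= g (A W) (A W) by have [->|/(fs_gt0 y)/ltW //] := eqVneq (A W) 0; rewrite fs0l.
    lra.
  by move/eqP: W0; rewrite /W scaleNr addrC subr_eq0 => /eqP.
have lin2 (i : 'I_2) : linear ((fun Z => g Z (tnth [tuple N; xi] i)) : E -> R^o).
  by move=> r v w; rewrite fsDl fsZl.
have [|X X0 HX] := exists_common_zero lin2; first exact: leq_trans (leq_add m1 m1).
have hX : hol X by split; [exact: HX ord0|exact: (HX (Ordinal (isT : 1 < 2)%N))].
have hiX := hol_imul hX; have := hopf_identity hX hiX.
rewrite /d (Aalpha _ hX) (Aalpha _ hiX) !imulZ imul_imul !(fsZl, fsZr) fs_imul fsNl.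
have := fs_gt0 y X0; rewrite -/alpha; nra.
Qed.

End ShapeOperatorAtPoint.

(** * Exterior derivatives along a hypersurface *)

(** The image of [L] lies in the kernel of the nonzero column [c], and both have dimension d - 1. *)
Lemma injective_hyperplane (R : fieldType) (n d : nat) (L : {linear 'rV[R]_n -> 'rV[R]_d})
    (c : 'cV[R]_d) (X : 'rV[R]_d) : n.+1 = d -> injective L -> c != 0 ->
  (forall v, L v *m c = 0) -> X *m c = 0 -> exists v, L v = X.
Proof.
move=> nd Linj c0 Lc Xc; pose M := lin1_mx L.
have Mfree : row_free M.
  rewrite -kermx_eq0; apply/eqP/row_matrixP => i; rewrite row0; apply: Linj.
  by rewrite linear0 -mul_rV_lin1 -row_mul mulmx_ker row0.
have MK : (M <= kermx c)%MS.
  by apply/sub_kermxP/row_matrixP => i; rewrite row_mul row0 rowE mul_rV_lin1 Lc.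
have rc : \rank c = 1%N.
  by apply/eqP; rewrite eqn_leq rank_leq_col lt0n mxrank_eq0.
have KM : (kermx c <= M)%MS.
  by rewrite -(mxrank_leqif_sup MK) mxrank_ker rc (eqP Mfree) -nd subn1.
have : (X <= M)%MS by apply: submx_trans KM; apply/sub_kermxP.
by move=> /submxP[v ->]; exists v; rewrite mul_rV_lin1.
Qed.

Section SmoothMaps.
Context {R : realType} {V W : normedModType R}.
Implicit Types (U : set V) (f : V -> W).

Lemma smooth_differentiable U f x : smooth_on U f -> U x -> differentiable f x.
Proof. by move=> /(_ 1%N)[df _] /df. Qed.

Lemma smooth_derive U f v : smooth_on U f -> smooth_on U ('D_v f).
Proof. by move=> sf r; have [_ /(_ v)] := sf r.+1. Qed.

Lemma smooth_subset U U' f : U' `<=` U -> smooth_on U f -> smooth_on U' f.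
Proof.
move=> UU sf r; have {sf} := sf r; elim: r f => [|r IH] f /=.
  by move=> cf x /set_mem/UU/mem_set/cf.
by move=> [df Df]; split=> [x /UU/df //|v]; apply: IH.
Qed.

Lemma is_derive_near_cst (F : V -> W) x v c d :
  (\forall y \near x, F y = c) -> is_derive x v F d -> d = 0.
Proof. by move=> Fc [_ <-]; rewrite (near_eq_derive (g := cst c)) // derive_cst. Qed.

End SmoothMaps.

(** The cross-multiplied form of proportionality avoids differentiating a quotient. Since [h], and
    hence [t], vanish at [x], the derivatives of [t0] and [h0] drop out of the product rule. *)
Lemma is_derive_proportional {R : realType} {V : normedModType R} (x w : V)
    (t h t0 h0 : V -> R) dt dh dt0 dh0 :
  is_derive x w t dt -> is_derive x w h dh ->
  is_derive x w t0 dt0 -> is_derive x w h0 dh0 ->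
  (\forall y \near x, t y * h0 y = t0 y * h y) ->
  h0 x = -1 -> h x = 0 -> dt = - t0 x * dh.
Proof.
move=> Ht Hh Ht0 Hh0 prop h0x hx.
have tx : t x = 0 by have := nbhs_singleton prop; rewrite h0x hx => H; lra.
have := is_deriveB (is_deriveM Ht Hh0) (is_deriveM Ht0 Hh).
have prop0 : \forall y \near x, (t * h0 - t0 * h) y = 0.
  by apply: filterS prop => y; rewrite !fctE => ->; rewrite subrr.
move=> /(is_derive_near_cst prop0); rewrite h0x hx tx /GRing.scale /=; lra.
Qed.

(* The Christoffel map turns the commutator of second covariant derivatives of N
   into the curvature tensor. *)
Lemma fs_commutator {R : realType} {m : nat} (y v w N h hN dvN dwN : 'rV[R]_(m + m)) :
  fs y N N = 1 -> fs y v (imul N) = 0 -> fs y w (imul N) = 0 ->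
  fs y (hN + (dGamma y w v N + Gamma y h N + Gamma y v dwN)
        + Gamma y w (dvN + Gamma y v N)) (imul N)
  - fs y (hN + (dGamma y v w N + Gamma y h N + Gamma y w dvN)
        + Gamma y v (dwN + Gamma y w N)) (imul N)
  = - 2 * fs y v (imul w).
Proof.
move=> N1 vN wN; have := fs_curvature y N v w.
rewrite N1 vN wN (fsC _ N (imul w)) (fsC _ N (imul v)) (fs_imull _ w) (fs_imull _ v) vN wN !GammaDr.
move: (dGamma y w v N) (dGamma y v w N) (Gamma y w (Gamma y v N)) (Gamma y v (Gamma y w N)).
move: (Gamma y h N) (Gamma y v dwN) (Gamma y w dvN) => G1 G2 G3 G4 G5 G6 G7.
rewrite !(fsDl, fsNl); lra.
Qed.

Section UnitNormal.
Context {R : realType} {n m : nat}.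
Local Notation E := 'rV[R]_(m + m).
Variables (W : set 'rV[R]_n) (f N : 'rV[R]_n -> E).
Hypotheses (W_open : open W) (f_smooth : smooth_on W f) (N_smooth : smooth_on W N)
  (N_unit : forall u, W u -> fs (f u) (N u) (N u) = 1)
  (N_normal : forall u v, W u -> fs (f u) (N u) ('D_v f u) = 0).

(** The covariant derivative of [N] along [f]; it is minus the shape operator at the image of
    [v]. *)
Definition dnormal v u : E := 'D_v N u + Gamma (f u) ('D_v f u) (N u).

Let near_W (P : 'rV[R]_n -> Prop) u : W u -> (forall u', W u' -> P u') ->
  \forall u' \near u, P u'.
Proof. by move=> Wu WP; apply: filterS WP _; exact: open_nbhs_nbhs. Qed.

Let f_derive u v : W u -> is_derive u v f ('D_v f u).
Proof. by move=> Wu; apply/derivableP/diff_derivable/(smooth_differentiable f_smooth). Qed.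

Let N_derive u v : W u -> is_derive u v N ('D_v N u).
Proof. by move=> Wu; apply/derivableP/diff_derivable/(smooth_differentiable N_smooth). Qed.

Let Df_derive u v w : W u -> is_derive u w ('D_v f) ('D_w ('D_v f) u).
Proof.
move=> Wu; apply/derivableP/diff_derivable.
exact: smooth_differentiable (smooth_derive v f_smooth) Wu.
Qed.

Let DN_derive u v w : W u -> is_derive u w ('D_v N) ('D_w ('D_v N) u).
Proof.
move=> Wu; apply/derivableP/diff_derivable.
exact: smooth_differentiable (smooth_derive v N_smooth) Wu.
Qed.

Let smooth_schwarz (h : 'rV[R]_n -> E) u v w : smooth_on W h -> W u ->
  'D_w ('D_v h) u = 'D_v ('D_w h) u.
Proof.
move=> sh Wu; apply: schwarz_row.
- by apply: near_W => // u' Wu'; exact: smooth_differentiable sh Wu'.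
- exact: smooth_differentiable (smooth_derive v sh) Wu.
- exact: smooth_differentiable (smooth_derive w sh) Wu.
Qed.

(* Here and below equalities between derivatives are composed as terms, since
   [rewrite] compares distinct derivatives by unfolding them to limits. *)
Let hessian_sym u v w : W u ->
  'D_w ('D_v f) u + Gamma (f u) ('D_w f u) ('D_v f u) =
  'D_v ('D_w f) u + Gamma (f u) ('D_v f u) ('D_w f u).
Proof.
by move=> Wu; exact: (congr2 +%R (smooth_schwarz v w f_smooth Wu) (GammaC _ _ _)).
Qed.

Lemma dnormal_tangent u v : W u -> fs (f u) (dnormal v u) (N u) = 0.
Proof.
move=> Wu; have := is_derive_fs (f_derive v Wu) (N_derive v Wu) (N_derive v Wu).
move=> /(is_derive_near_cst (near_W Wu N_unit)).
rewrite -/(dnormal v u) (fsC _ (N u)) => H; lra.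
Qed.

(** Differentiating g(N, D_a f) = 0 along b gives minus the normal component of the Hessian of [f],
    which is symmetric. This is the symmetry of the shape operator. *)
Lemma dnormal_sym u v w : W u ->
  fs (f u) (dnormal w u) ('D_v f u) = fs (f u) (dnormal v u) ('D_w f u).
Proof.
move=> Wu.
have D a b : fs (f u) (dnormal b u) ('D_a f u) =
    - fs (f u) (N u) ('D_b ('D_a f) u + Gamma (f u) ('D_b f u) ('D_a f u)).
  apply/eqP; rewrite -addr_eq0; apply/eqP.
  have := is_derive_fs (f_derive b Wu) (N_derive b Wu) (Df_derive a b Wu).
  by apply: is_derive_near_cst; apply: near_W => // u' Wu'; exact: N_normal.
apply: etrans (D v w) _; apply: etrans _ (esym (D w v)).
exact: (congr1 (fun h => - fs (f u) (N u) h) (hessian_sym v w Wu)).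
Qed.

(* [eta_form] is minus the pullback of the contact form [eta] of the hypersurface. *)
Definition eta_form v u : R := fs (f u) ('D_v f u) (imul (N u)).
(** As J N is minus the Reeb vector xi, this is g(A X, xi) with X the image of [v]. *)
Definition theta_form v u : R := fs (f u) (dnormal v u) (imul (N u)).

Let is_derive_iN u w : W u -> is_derive u w (fun y => imul (N y)) (imul ('D_w N u)).
Proof. by move=> Wu; exact: is_derive_imul (N_derive w Wu). Qed.

Let nabla_iN u w : imul ('D_w N u) + Gamma (f u) ('D_w f u) (imul (N u)) = imul (dnormal w u).
Proof. by rewrite Gamma_imul -imulD. Qed.

Lemma is_derive_eta u v w : W u -> is_derive u w (eta_form v)
  (fs (f u) ('D_w ('D_v f) u + Gamma (f u) ('D_w f u) ('D_v f u)) (imul (N u))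
   + fs (f u) ('D_v f u) (imul (dnormal w u))).
Proof.
move=> Wu; rewrite -nabla_iN.
exact: is_derive_fs (f_derive w Wu) (Df_derive v w Wu) (is_derive_iN w Wu).
Qed.

Lemma is_derive_theta u v w : W u -> is_derive u w (theta_form v)
  (fs (f u) ('D_w ('D_v N) u + (dGamma (f u) ('D_w f u) ('D_v f u) (N u)
      + Gamma (f u) ('D_w ('D_v f) u) (N u) + Gamma (f u) ('D_v f u) ('D_w N u))
     + Gamma (f u) ('D_w f u) (dnormal v u)) (imul (N u))
   + fs (f u) (dnormal v u) (imul (dnormal w u))).
Proof.
move=> Wu; rewrite -nabla_iN.
have DG := is_derive_Gamma (f_derive w Wu) (Df_derive v w Wu) (N_derive w Wu).
exact: is_derive_fs (f_derive w Wu) (is_deriveD (DN_derive v w Wu) DG) (is_derive_iN w Wu).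
Qed.

(** Constant parameter fields commute, so the left side is an exterior derivative; the Hessian terms
    cancel. *)
Lemma exterior_eta u v w : W u -> 'D_w (eta_form v) u - 'D_v (eta_form w) u =
  fs (f u) ('D_v f u) (imul (dnormal w u)) - fs (f u) ('D_w f u) (imul (dnormal v u)).
Proof.
move=> Wu.
have H : forall p q r : R, p + q - (p + r) = q - r by move=> *; ring.
have E1 := derive_val (is_derive := is_derive_eta v w Wu).
have E2 := derive_val (is_derive := is_derive_eta w v Wu).
have {}E2 := etrans E2 (congr1 (fun h => fs (f u) h (imul (N u)) + _) (hessian_sym w v Wu)).
exact: etrans (congr2 (fun p q => p - q) E1 E2) (H _ _ _).
Qed.

(** The second derivatives of [f] and [N] cancel. What remains of the Christoffel terms is
    curvature, which on the kernel of eta reduces to the last product. *)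
Lemma exterior_theta u v w : W u ->
  eta_form v u = 0 -> eta_form w u = 0 ->
  'D_w (theta_form v) u - 'D_v (theta_form w) u =
  2 * fs (f u) (dnormal v u) (imul (dnormal w u))
  - 2 * fs (f u) ('D_v f u) (imul ('D_w f u)).
Proof.
move=> Wu.
have H : forall p q r s t : R, p - q = - 2 * r -> t = - s -> p + s - (q + t) = 2 * s - 2 * r.
  by move=> *; lra.
move=> ev ew; have E1 := derive_val (is_derive := is_derive_theta v w Wu).
have E2 := derive_val (is_derive := is_derive_theta w v Wu).
have {}E2 := etrans E2 (congr2 (fun h hN => fs (f u) (hN
  + (dGamma (f u) ('D_v f u) ('D_w f u) (N u) + Gamma (f u) h (N u)
     + Gamma (f u) ('D_w f u) ('D_v N u))
  + Gamma (f u) ('D_v f u) (dnormal w u)) (imul (N u))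
  + fs (f u) (dnormal w u) (imul (dnormal v u)))
  (smooth_schwarz w v f_smooth Wu) (smooth_schwarz w v N_smooth Wu)).
apply: etrans (congr2 (fun p q => p - q) E1 E2) _; apply: H; last exact: fs_imulC.
exact: fs_commutator (N_unit Wu) ev ew.
Qed.

(** On the kernel of eta, proportionality gives d theta = - theta(v0) d eta; both sides are then
    computed by the two preceding lemmas. In the application [v0] parametrizes the Reeb vector and
    theta(v0) is alpha. *)
Lemma hopf_identity_forms u v0 v w : W u ->
  (forall u' a, W u' ->
     theta_form a u' * eta_form v0 u' = theta_form v0 u' * eta_form a u') ->
  eta_form v0 u = -1 -> eta_form v u = 0 -> eta_form w u = 0 ->
  2 * fs (f u) (dnormal v u) (imul (dnormal w u))
  - 2 * fs (f u) ('D_v f u) (imul ('D_w f u)) =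
  - theta_form v0 u * (fs (f u) ('D_v f u) (imul (dnormal w u))
                       - fs (f u) ('D_w f u) (imul (dnormal v u))).
Proof.
move=> Wu prop e0 ev ew.
have D a b : eta_form a u = 0 ->
    'D_b (theta_form a) u = - theta_form v0 u * 'D_b (eta_form a) u.
  have th c : is_derive u b (theta_form c) ('D_b (theta_form c) u).
    by apply: derivableP; case: (is_derive_theta c b Wu).
  have et c : is_derive u b (eta_form c) ('D_b (eta_form c) u).
    by apply: derivableP; case: (is_derive_eta c b Wu).
  apply: (is_derive_proportional (th a) (et a) (th v0) (et v0)) e0.
  exact: (near_W Wu (fun u' Wu' => prop u' a Wu')).
apply: etrans (esym (exterior_theta Wu ev ew)) _.
apply: etrans (congr2 (fun p q => p - q) (D v w ev) (D w v ew)) _.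
apply: etrans (esym (mulrBr _ _ _)) _.
exact: (congr1 (fun p => - theta_form v0 u * p) (exterior_eta v w Wu)).
Qed.

End UnitNormal.

(** * From a hypersurface in a chart to the pointwise contradiction *)

Section Hypersurface.
Context {R : realType} {n m : nat}.
Local Notation E := 'rV[R]_(m + m).
Variables (j : 'I_m.+1) (f N : 'rV[R]_n -> E) (W : set 'rV[R]_n) (k : R).
Hypotheses (nm : n.+1 = (m + m)%N) (W_open : open W) (f_smooth : smooth_on W f)
  (f_immersion : forall u, W u -> injective ('d f u))
  (N_normal : is_unit_normal j f N W)
  (commutes : forall u X Y, W u ->
     holomorphic_distr j f N u X -> holomorphic_distr j f N u Y ->
     shape_torsion j f N u k X (phi j f N u Y) =
     phi j f N u (shape_torsion j f N u k X Y)).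

Let N_smooth : smooth_on W N. Proof. by case: N_normal. Qed.

Let df u v : W u -> 'd f u v = 'D_v f u.
Proof. by move=> Wu; rewrite deriveE //; exact: smooth_differentiable f_smooth Wu. Qed.

Let dN u v : W u -> 'd N u v = 'D_v N u.
Proof. by move=> Wu; rewrite deriveE //; exact: smooth_differentiable N_smooth Wu. Qed.

Let dnormalE u v : W u -> 'd N u v + Gamma (f u) ('d f u v) (N u) = dnormal f N v u.
Proof.
move=> Wu.
exact: (congr2 +%R (dN v Wu) (congr1 (fun a => Gamma (f u) a (N u)) (df v Wu))).
Qed.

Let N_unit u : W u -> fs (f u) (N u) (N u) = 1.
Proof. by move=> Wu; have [_ /(_ u Wu)[]] := N_normal; rewrite fubini_studyE. Qed.

Let N_orth u v : W u -> fs (f u) (N u) ('D_v f u) = 0.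
Proof.
by move=> Wu; rewrite -df //; have [_ /(_ u Wu)[_ /(_ v)]] := N_normal; rewrite fubini_studyE.
Qed.

(** The image of the injective differential fills the hyperplane orthogonal to [N], cut out by the
    column [c] representing g(., N). *)
Lemma tangent_atP u X : W u -> tangent_at (f u) (N u) X <-> exists v, 'd f u v = X.
Proof.
move=> Wu; split=> [XN|[v <-]]; last by rewrite df // /tangent_at fsC N_orth.
pose c : 'cV[R]_(m + m) := \col_i fs (f u) (delta_mx 0 i) (N u).
have fs_c (v : E) : (v *m c) 0 0 = fs (f u) v (N u).
  rewrite (linear_form_delta (L := fun w => fs (f u) w (N u))).
    by rewrite mxE; apply: eq_bigr => i _; rewrite mxE.
  by move=> r a b; rewrite fsDl fsZl.
have fs0_c (v : E) : fs (f u) v (N u) = 0 -> v *m c = 0.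
  by move=> vN; apply/matrixP => a b; rewrite !ord1 fs_c vN mxE.
apply: (injective_hyperplane (L := 'd f u) nm (f_immersion Wu) (c := c)) => //.
- apply/eqP => c0; have := N_unit Wu; rewrite -fs_c c0 mulmx0 mxE => /eqP.
  by rewrite eq_sym oner_eq0.
- by move=> v; apply: fs0_c; rewrite df // fsC N_orth.
- exact: fs0_c.
Qed.

Local Notation A u := (shape_op j f N u).

(** Injectivity of the differential makes the vector chosen by [param_vec] equal to [v]. *)
Lemma shape_opE u v : W u -> A u ('d f u v) = - dnormal f N v u.
Proof.
move=> Wu; rewrite /shape_op /nabla_normal fubini_studyE levi_civita_fs.
have -> : param_vec f u ('d f u v) = v.
  by apply: xget_unique => // w; exact: f_immersion.
exact: (congr1 -%R (dnormalE v Wu)).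
Qed.

Let A_tangent u X : W u -> tangent_at (f u) (N u) X -> tangent_at (f u) (N u) (A u X).
Proof.
move=> Wu /(tangent_atP _ Wu)[v <-]; rewrite shape_opE // /tangent_at fsNl.
by rewrite (dnormal_tangent W_open f_smooth N_smooth N_unit v Wu) oppr0.
Qed.

Let A_sym u X Y : W u -> tangent_at (f u) (N u) X -> tangent_at (f u) (N u) Y ->
  fs (f u) (A u X) Y = fs (f u) X (A u Y).
Proof.
move=> Wu /(tangent_atP _ Wu)[v <-] /(tangent_atP _ Wu)[w <-].
rewrite (shape_opE v Wu) (shape_opE w Wu) fsNl fsNr; congr (- _).
apply: etrans (congr1 (fs (f u) _) (df w Wu)) _; rewrite fsC; apply: esym.
apply: etrans (congr1 (fun a => fs (f u) a _) (df v Wu)) _; rewrite fsC; apply: esym.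
rewrite fsC; exact: (dnormal_sym W_open f_smooth N_smooth N_orth).
Qed.

Let A_lin u r X Y : W u -> tangent_at (f u) (N u) X -> tangent_at (f u) (N u) Y ->
  A u (r *: X + Y) = r *: A u X + A u Y.
Proof.
move=> Wu /(tangent_atP _ Wu)[v <-] /(tangent_atP _ Wu)[w <-].
have AE a : A u ('d f u a) = - ('d N u a + Gamma (f u) (N u) ('d f u a)).
  apply: etrans (shape_opE a Wu) (congr1 -%R (etrans (esym (dnormalE a Wu)) _)).
  by rewrite GammaC.
apply: etrans (congr1 (A u) (esym (linearP ('d f u) r v w))) _.
have alg a b c d : - ((r *: a + b) + Gamma (f u) (N u) (r *: c + d)) =
    r *: - (a + Gamma (f u) (N u) c) + - (b + Gamma (f u) (N u) d).
  by rewrite GammaDr GammaZr scalerN -opprD scalerDr addrACA.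
apply: etrans (AE _) (etrans _ (esym (congr2 (fun a b => r *: a + b) (AE v) (AE w)))).
apply: etrans (congr1 -%R (congr2 +%R (linearP ('d N u) r v w)
  (congr1 (Gamma (f u) (N u)) (linearP ('d f u) r v w)))) _.
exact: alg.
Qed.

Let hol_distr u X : W u -> hol (f u) (N u) X -> holomorphic_distr j f N u X.
Proof.
by move=> Wu [/(tangent_atP _ Wu) tX Xxi]; split=> //; rewrite fubini_studyE /reeb -imul_J.
Qed.

(** The let-bound parameters spell out the notations of the pointwise section, with [imul] for [J],
    so that both forms of the condition agree by conversion. *)
Let A_commutes u X Y (g := fs (f u)) (xi := - imul (N u))
    (phi := fun X => imul X - g X xi *: N u)
    (cho := fun X Y => g (phi (A u X)) Y *: xi - g Y xi *: phi (A u X)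
                       - (k * g X xi) *: phi Y)
    (st := fun X Y => cho X (A u Y) - cho (A u Y) X - A u (cho X Y - cho Y X)) :
  W u -> hol (f u) (N u) X -> hol (f u) (N u) Y -> st X (phi Y) = phi (st X Y).
Proof.
move=> Wu hX hY; have := commutes Wu (hol_distr Wu hX) (hol_distr Wu hY).
rewrite /shape_torsion /torsion /Defs.cho /Defs.phi /Defs.eta /reeb fubini_studyE -imul_J.
exact.
Qed.

Lemma no_commuting_hypersurface u0 : (2 < m)%N -> k != 0 -> W u0 -> False.
Proof.
move=> m2 k0 Wu0.
(* This is established on all of [W], since the relation between theta and eta is differentiated at
   [u0]. *)
have reeb_principal u : W u ->
    A u (- imul (N u)) = fs (f u) (A u (- imul (N u))) (- imul (N u)) *: - imul (N u).
  move=> Wu; apply: (shape_op_reeb (N_unit Wu)) m2 k0 => [X|X Y|r X Y|X Y].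
  - exact: A_tangent. - exact: A_sym. - exact: A_lin. - exact: A_commutes.
have tan_xi u : W u -> tangent_at (f u) (N u) (- imul (N u)).
  by move=> Wu; rewrite /tangent_at fsNl fs_imull fs_imulr !oppr0.
apply: (hopf_contradiction (N_unit Wu0) _ _ _ _ _ (ltnW m2) (reeb_principal _ Wu0)).
- by move=> X; exact: A_tangent.
- by move=> X Y; exact: A_sym.
- by move=> r X Y; exact: A_lin.
- by move=> X Y; exact: A_commutes.
pose alpha u := fs (f u) (A u (- imul (N u))) (- imul (N u)).
have theta_eta u v : W u -> theta_form f N v u = - alpha u * eta_form f N v u.
  move=> Wu; have tv : tangent_at (f u) (N u) ('d f u v) by apply/(tangent_atP _ Wu); exists v.
  have alg (P V0 Q : E) (a : R) : fs (f u) (- P) (- Q) = fs (f u) V0 (a *: - Q) ->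
      fs (f u) P Q = - a * fs (f u) V0 Q.
    by rewrite fsNl fsNr opprK fsZr fsNr mulrN mulNr.
  have := etrans (esym (congr1 (fun b => fs (f u) b _) (shape_opE v Wu)))
    (etrans (A_sym Wu tv (tan_xi u Wu)) (congr1 (fs (f u) _) (reeb_principal u Wu))).
  move=> /alg H.
  exact: etrans H (congr1 (fun a => - alpha u * fs (f u) a (imul (N u))) (df v Wu)).
have [v0 Dv0] : exists v, 'd f u0 v = - imul (N u0) by apply/(tangent_atP _ Wu0); exact: tan_xi.
have e0 : eta_form f N v0 u0 = -1.
  apply: etrans (congr1 (fun a => fs (f u0) a (imul (N u0))) (etrans (esym (df v0 Wu0)) Dv0)) _.
  by rewrite fsNl fs_imul N_unit.
(* Eliminating alpha between the relations for [a] and [v0] means that alpha itself is never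
   differentiated. *)
have prop u a : W u -> theta_form f N a u * eta_form f N v0 u
    = theta_form f N v0 u * eta_form f N a u.
  have H (p q r : R) : - p * q * r = - p * r * q by ring.
  move=> Wu; exact: etrans (congr1 (fun t => t * _) (theta_eta u a Wu))
    (etrans (H _ _ _) (esym (congr1 (fun t => t * _) (theta_eta u v0 Wu)))).
move=> X Y [/(tangent_atP _ Wu0)[v Dv] Xxi] [/(tangent_atP _ Wu0)[w Dw] Yxi].
have Dv' : 'D_v f u0 = X := etrans (esym (df v Wu0)) Dv.
have Dw' : 'D_w f u0 = Y := etrans (esym (df w Wu0)) Dw.
have eta0 a Z : 'D_a f u0 = Z -> fs (f u0) Z (- imul (N u0)) = 0 -> eta_form f N a u0 = 0.
  move=> Da; rewrite fsNr => /eqP; rewrite oppr_eq0 => /eqP H.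
  exact: etrans (congr1 (fun b => fs (f u0) b (imul (N u0))) Da) H.
have := hopf_identity_forms W_open f_smooth N_smooth N_unit Wu0
  prop e0 (eta0 _ _ Dv' Xxi) (eta0 _ _ Dw' Yxi).
have AX : A u0 X = - dnormal f N v u0 by apply: etrans (shape_opE v Wu0); rewrite Dv.
have AY : A u0 Y = - dnormal f N w u0 by apply: etrans (shape_opE w Wu0); rewrite Dw.
rewrite Dv' Dw' (theta_eta _ _ Wu0) e0 AX AY -/(alpha u0).
move: (dnormal f N v u0) (dnormal f N w u0) (alpha u0) => P Q a.
rewrite !imulN !fsE !fs_imull (fs_imulC _ P Y) (fs_imulC _ Q X); lra.
Qed.

End Hypersurface.

Theorem theorem7 (R : realType) (m : nat) (hm : (3 <= m)%N) (k : R)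
    (hk : k != 0) :
  ~ exists M : real_hypersurface R m, shape_torsion_commutes M k.
Proof.
move=> [M HM]; have [p _] := hs_nonempty M.
have [c [j [W [N [[hc hp] [W_open Wp] WU N_normal comm]]]]] := HM p.
have [_ f_smooth f_imm] := hs_immersion (r := M) j hc.
(* The predecessor truncates at 0, so positivity of [m] enters here. *)
have mm : (m.*2.-1.+1 = m + m)%N.
  by rewrite addnn prednK // double_gt0 (leq_trans _ hm).
exact: (no_commuting_hypersurface mm W_open (smooth_subset WU f_smooth)
  (fun u Wu => f_imm u (WU u Wu)) N_normal comm hm hk Wp).
Qed.
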